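(* Let $n\ge 3$, $\rho_1>0$, $\beta>0$ and $\alpha=2\beta+\rho_1$. Suppose that $v$ is a radially symmetric solution of $$\Delta\log v+\alpha v+\beta x\cdot\nabla v=0,\quad v>0,\quad\text{in }\mathbb{R}^n\setminus B_1.$$ Then $$\lim_{r\to\infty}r^2v(r)=\frac{2(n-2)}{\alpha-2\beta}.$$
   Context: $B_1=\{x\in\mathbb{R}^n:|x|<1\}$. A solution is a positive $C^2$ function satisfying the equation in the classical sense on the stated set. A radially symmetric $v$ is also written as a function $v(r)$ of $r=|x|$. *)

(* Defs.v *)
From mathcomp Require Import all_boot all_order all_algebra.
From mathcomp Require Import all_classical all_reals all_analysis.
Import Order.TTheory GRing.Theory Num.Theory.
Import numFieldNormedType.Exports.

Set Implicit Arguments.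
Unset Strict Implicit.
Unset Printing Implicit Defensive.

Local Open Scope classical_set_scope.
Local Open Scope ring_scope.

Definition dotp (R : realType) (n : nat) (x y : 'rV[R]_n) : R :=
  \sum_(i < n) x 0 i * y 0 i.

(* The library norm on 'rV[R]_n is the sup norm, so the Euclidean norm is
   defined here; both norms induce the same topology. *)
Definition enorm (R : realType) (n : nat) (x : 'rV[R]_n) : R :=
  Num.sqrt (dotp x x).

Definition unit_ball (R : realType) (n : nat) : set 'rV[R]_n :=
  [set x | enorm x < 1].
Arguments unit_ball : clear implicits.

Definition basis_vec (R : realType) (n : nat) (i : 'I_n) : 'rV[R]_n :=
  delta_mx 0 i.

Definition partial (R : realType) (n : nat) (i : 'I_n) (f : 'rV[R]_n -> R) :
    'rV[R]_n -> R :=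
  fun x => 'D_(basis_vec R i) f x.

Definition gradient (R : realType) (n : nat) (f : 'rV[R]_n -> R)
    (x : 'rV[R]_n) : 'rV[R]_n :=
  \row_(i < n) partial i f x.

Definition laplacian (R : realType) (n : nat) (f : 'rV[R]_n -> R)
    (x : 'rV[R]_n) : R :=
  \sum_(i < n) partial i (partial i f) x.

(* Intended for an open set U. *)
Definition C2_open (R : realType) (n : nat) (U : set 'rV[R]_n)
    (f : 'rV[R]_n -> R) : Prop :=
  forall x, U x ->
    [/\ {for x, continuous f},
        (forall i : 'I_n, derivable f x (basis_vec R i) /\
           {for x, continuous (partial i f)}) &
        (forall i j : 'I_n, derivable (partial i f) x (basis_vec R j) /\
           {for x, continuous (partial j (partial i f))})].

(* Positive classical C^2 solution of
     Delta (log v) + alpha v + beta x . grad v = 0   on A.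
   The set A need not be open: being C^2 on A means having a C^2 extension w
   to an open neighbourhood U of A.  The values of v outside A play no role.
   When A is the closure of its interior, as for the exterior of a ball, the
   derivatives of w at the points of A do not depend on the extension. *)
Definition log_diffusion_solution (R : realType) (n : nat) (alpha beta : R)
    (A : set 'rV[R]_n) (v : 'rV[R]_n -> R) : Prop :=
  (forall x, A x -> 0 < v x) /\
  exists (U : set 'rV[R]_n) (w : 'rV[R]_n -> R),
    [/\ open U, A `<=` U, C2_open U w,
        (forall x, A x -> w x = v x) &
        (forall x, A x ->
           laplacian (fun y => ln (w y)) x + alpha * w x
             + beta * dotp x (gradient w x) = 0)].

(* v is radially symmetric on A, and phi is v as a function of r = |x|. *)
Definition radial_on (R : realType) (n : nat) (A : set 'rV[R]_n)
    (v : 'rV[R]_n -> R) (phi : R -> R) : Prop :=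
  forall x, A x -> v x = phi (enorm x).

(* Main.v *)
Require Import Defs.
From mathcomp Require Import all_boot all_order all_algebra.
From mathcomp Require Import all_classical all_reals all_analysis.
From mathcomp Require Import ring lra.
Import Order.TTheory GRing.Theory Num.Theory.
Import numFieldNormedType.Exports.

Set Implicit Arguments.
Unset Strict Implicit.
Unset Printing Implicit Defensive.

Local Open Scope classical_set_scope.
Local Open Scope ring_scope.

(** The weight r^2 turns the radial equation into an autonomous one.  Write
    l = (log phi)', where v(x) = phi(|x|).  On the ray through a basis vector e,
    the second derivative of log v in the direction e is l', and in each of the
    n - 1 orthogonal directions it is l / r, so the equation becomes
      l' + (n - 1) l / r + alpha phi + beta r phi' = 0   for r > 1
    ([radial_ode]).  Put m = n - 2, k = 2m, b = 2 m beta / rho1,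
      s = rho1 r^2 phi / (2m)   and   q = r s' / s = r l + 2.
    Since alpha - 2 beta = rho1, this gives
      r s' = s q,   r q' = - (m + b s) q - k (s - 1),
    a damped oscillator for log s in the time log r, and the theorem says that
    s tends to the equilibrium 1.

    The energy E = q^2 / 2 + k (s - 1 - log s) is nonnegative and satisfies
    r E' = - (m + b s) q^2 <= 0 ([is_derive_energy], [energy_nincr]), so s and q
    stay bounded ([damped_system_bounded]).  For a suitable small eps > 0
    the corrected energy E + eps q (s - 1) is still bounded below and decreases at
    least at the rate c (q^2 + (s - 1)^2) in log r ([lyapunov_dissipation]).
    Hence q^2 + (s - 1)^2 takes arbitrarily small values
    ([damped_system_liminf]); there E is small, and as E is nonincreasing it is
    small from then on.  As E controls (s - 1)^2 for bounded s
    ([subr1_ln_ge_sqr]), s tends to 1 ([damped_system_cvg]). *)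

(** * Bounds for x - 1 - ln x *)

Lemma ln_le_subr1 (R : realType) (x : R) : 0 < x -> ln x <= x - 1.
Proof.
move=> x0; have := @le_ln1Dx R (x - 1).
by rewrite [1 + _]addrC subrK; apply; rewrite ltrBrDl subrr.
Qed.

Lemma subr1_ln_ge0 (R : realType) (x : R) : 0 < x -> 0 <= x - 1 - ln x.
Proof. by move=> /ln_le_subr1; rewrite subr_ge0. Qed.

Lemma subr1_ln_coercive (R : realType) (x : R) :
  0 < x -> x / 2 - 1 <= x - 1 - ln x.
Proof.
move=> x0.
have h1 : ln (x / 2) <= x / 2 - 1 by apply: ln_le_subr1; rewrite divr_gt0.
have h2 : ln (2 : R) <= 2 - 1 by exact: ln_le_subr1.
have : ln x = ln (x / 2) + ln 2.
  by rewrite -lnM ?posrE ?divr_gt0// divfK// pnatr_eq0.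
lra.
Qed.

Lemma subr1_ln_ge_sqr (R : realType) (x : R) :
  0 < x -> (x - 1) ^+ 2 <= 2 * (x + 1) * (x - 1 - ln x).
Proof.
move=> x0; set y := Num.sqrt x.
have y0 : 0 < y by rewrite sqrtr_gt0.
have xE : x = y ^+ 2 by rewrite sqr_sqrtr// ltW.
have lnE : ln x = 2 * ln y by rewrite xE lnXn// mulr_natl.
have := @ln_le_subr1 R y y0.
rewrite lnE; move: (ln y) => l hl.
have h : (y - 1) ^+ 2 <= x - 1 - 2 * l by rewrite xE; nra.
apply: (@le_trans _ _ (2 * (x + 1) * (y - 1) ^+ 2)).
  rewrite xE -subr_ge0.
  have -> : 2 * (y ^+ 2 + 1) * (y - 1) ^+ 2 - (y ^+ 2 - 1) ^+ 2 =
     ((y - 1) * (y - 1)) ^+ 2 by ring.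
  exact: sqr_ge0.
by apply: ler_wpM2l => //; lra.
Qed.

Lemma subr1_ln_le_sqr (R : realType) (x : R) :
  2^-1 <= x -> x - 1 - ln x <= 2 * (x - 1) ^+ 2.
Proof.
move=> hx; have x0 : 0 < x by lra.
have := @ln_le_subr1 R x^-1; rewrite invr_gt0 => /(_ x0).
rewrite lnV ?posrE// => h.
apply: (@le_trans _ _ (x - 2 + x^-1)); first lra.
have -> : x - 2 + x^-1 = x^-1 * (x - 1) ^+ 2 by field; rewrite gt_eqF.
apply: ler_wpM2r; first exact: sqr_ge0.
by rewrite invf_ple ?posrE.
Qed.

(** * Derivatives and monotonicity on the real line *)

Lemma is_derive1M (R : realType) (f g : R -> R) (x a b : R) :
  is_derive x 1 f a -> is_derive x 1 g b ->
  is_derive x 1 (fun y => f y * g y) (f x * b + g x * a).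
Proof. by move=> fa gb; exact: is_deriveM. Qed.

Lemma is_derive1D (R : realType) (f g : R -> R) (x a b : R) :
  is_derive x 1 f a -> is_derive x 1 g b ->
  is_derive x 1 (fun y => f y + g y) (a + b).
Proof. by move=> fa gb; exact: is_deriveD. Qed.

Lemma is_derive1Ml (R : realType) (c : R) (f : R -> R) (x a : R) :
  is_derive x 1 f a -> is_derive x 1 (fun y => c * f y) (c * a).
Proof. by move=> fa; exact: is_deriveZ. Qed.

Lemma is_derive1Dr (R : realType) (c : R) (f : R -> R) (x a : R) :
  is_derive x 1 f a -> is_derive x 1 (fun y => f y + c) a.
Proof.
move=> fa; rewrite -[a]addr0.
by apply: is_derive1D => //; exact: is_derive_cst.
Qed.

Lemma is_derive1_lnf (R : realType) (f : R -> R) (x a : R) :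
  0 < f x -> is_derive x 1 f a -> is_derive x 1 (fun y => ln (f y)) (a / f x).
Proof.
move=> fx fa; rewrite mulrC.
by apply: is_derive1_comp; exact: is_derive1_ln.
Qed.

Lemma is_derive_le0_nincr (R : realType) (a : R) (f f' : R -> R) :
  (forall r : R, a < r -> is_derive r 1 f (f' r)) ->
  forall x, a < x -> (forall r, x < r -> f' r <= 0) ->
  forall y, x <= y -> f y <= f x.
Proof.
move=> df x ax f'0 y xy.
apply: (@ler0_derive1_nincry R f x) => //.
- move=> r; rewrite in_itv/= andbT => xr.
  by have [] := df r (lt_trans ax xr).
- move=> r; rewrite in_itv/= andbT => xr.
  have [_] := df r (lt_trans ax xr).
  by rewrite -derive1E => ->; exact: f'0.
- apply: derivable_within_continuous => r; rewrite in_itv/= andbT => xr.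
  by have [] := df r (lt_le_trans ax xr).
Qed.

(** * Convergence of a damped planar system *)

(** Along [damped_system] below, the left-hand side is r times the derivative of
    E + e q (s - 1), and C bounds the damping coefficient m + b s. *)
Lemma lyapunov_dissipation (R : realType) (m b k M C e s q : R) :
  0 < m -> 0 <= b -> 0 < k -> 0 < s -> s <= M -> C = m + b * M -> 0 <= e ->
  e * (M + C ^+ 2 / (2 * k)) = m / 2 ->
  - (m + b * s) * q ^+ 2
    + e * (- (m + b * s) * (q * (s - 1)) - k * (s - 1) ^+ 2 + s * q ^+ 2)
  <= - (m / 2) * q ^+ 2 - e * k / 2 * (s - 1) ^+ 2.
Proof.
move=> m0 b0 k0 s0 sM CE e0 eE.
set a := m + b * s.
have bs : 0 <= b * s by rewrite mulr_ge0// ltW.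
have ma : m <= a by rewrite lerDl.
have aC : a <= C by rewrite CE lerD2l ler_wpM2l.
have a2 : a ^+ 2 <= C ^+ 2 by rewrite ler_sqr ?nnegrE; lra.
have q2 := sqr_ge0 q.
have k2 : 0 < 2 * k by lra.
(* The indefinite cross term is absorbed by Young's inequality, with the
   weight that costs half of the term k (s - 1)^2. *)
have young : - a * (q * (s - 1)) <= k / 2 * (s - 1) ^+ 2 + C ^+ 2 / (2 * k) * q ^+ 2.
  apply: (@le_trans _ _ (k / 2 * (s - 1) ^+ 2 + a ^+ 2 / (2 * k) * q ^+ 2)).
    rewrite -subr_ge0.
    have -> : k / 2 * (s - 1) ^+ 2 + a ^+ 2 / (2 * k) * q ^+ 2 - - a * (q * (s - 1))
      = (k * (s - 1) + a * q) ^+ 2 / (2 * k) by field; rewrite gt_eqF.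
    by rewrite divr_ge0 ?sqr_ge0// ltW.
  by rewrite lerD2l ler_wpM2r// ler_wpM2r// invr_ge0 ltW.
have sq : s * q ^+ 2 <= M * q ^+ 2 by rewrite ler_wpM2r.
have aq : m * q ^+ 2 <= a * q ^+ 2 by rewrite ler_wpM2r.
have : e * (- a * (q * (s - 1)) - k * (s - 1) ^+ 2 + s * q ^+ 2) <=
  e * ((M + C ^+ 2 / (2 * k)) * q ^+ 2 - k / 2 * (s - 1) ^+ 2).
  by apply: ler_wpM2l => //; lra.
rewrite [X in _ <= X -> _]mulrBr [e * (_ * q ^+ 2)]mulrA eE; lra.
Qed.

(** The damped oscillator y'' + (m + b exp y) y' + k (exp y - 1) = 0 in the time
    log r, for r > 1, as a first-order system in s = exp y and q = r y'. *)
Definition damped_system (R : realType) (m b k : R) (s q : R -> R) : Prop :=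
  [/\ [/\ 0 < m, 0 <= b & 0 < k],
      forall r : R, 1 < r -> 0 < s r,
      forall r : R, 1 < r -> is_derive r 1 s (s r * q r / r) &
      forall r : R, 1 < r ->
        is_derive r 1 q (- ((m + b * s r) * q r + k * (s r - 1)) / r)].

(** The kinetic energy plus the potential of the restoring force k (s - 1),
    which is minimal, equal to 0, at s = 1. *)
Definition energy (R : realType) (k : R) (s q : R -> R) (r : R) : R :=
  q r ^+ 2 / 2 + k * (s r - 1 - ln (s r)).

Lemma is_derive_energy (R : realType) (m b k : R) (s q : R -> R) (r : R) :
  damped_system m b k s q -> 1 < r ->
  is_derive r 1 (energy k s q) (- (m + b * s r) * q r ^+ 2 / r).
Proof.
move=> [[m0 b0 k0] s0 ds dq] r1; have sr := s0 r r1.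
have -> : energy k s q =
    fun r => 2^-1 * (q r * q r) + k * ((s r + (-1)) + (-1) * ln (s r)).
  by apply/funext => x; rewrite /energy; ring.
have h := is_derive1D (is_derive1Ml 2^-1 (is_derive1M (dq r r1) (dq r r1)))
  (is_derive1Ml k (is_derive1D (is_derive1Dr (-1) (ds r r1))
                               (is_derive1Ml (-1) (is_derive1_lnf sr (ds r r1))))).
apply: (is_derive_eq h).
rewrite /=; field; rewrite !gt_eqF//; lra.
Qed.

Lemma energy_nincr (R : realType) (m b k : R) (s q : R -> R) :
  damped_system m b k s q ->
  forall x, 1 < x -> forall y, x <= y -> energy k s q y <= energy k s q x.
Proof.
move=> sys x x1.
have dE r := @is_derive_energy R m b k s q r sys.
apply: (is_derive_le0_nincr dE x1) => r xr.
have [[m0 b0 k0] s0 _ _] := sys.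
have r0 : 0 < r by lra.
have sr : 0 < s r by apply: s0; lra.
rewrite ler_pdivrMr// mul0r mulNr oppr_le0 mulr_ge0 ?sqr_ge0//.
by rewrite addr_ge0 ?mulr_ge0//; exact: ltW.
Qed.

(** Both bounds follow from E r <= E 2: the bound on s from the linear growth of
    the potential, see [subr1_ln_coercive], and the one on q from the kinetic
    term. *)
Lemma damped_system_bounded (R : realType) (m b k : R) (s q : R -> R)
    (E := energy k s q 2) (M := 2 * (E / k + 1)) :
  damped_system m b k s q ->
  2 <= M /\
  forall r, 2 <= r -> [/\ 0 < s r, s r <= M & q r ^+ 2 <= 2 * E].
Proof.
move=> sys; have [[m0 b0 k0] s0 _ _] := sys.
suff bnd r : 2 <= r -> [/\ 0 < s r, s r <= M & q r ^+ 2 <= 2 * E].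
  split=> //.
  have E0 : 0 <= E.
    have [+ _ +] := @bnd 2 (lexx _) => _.
    by have := sqr_ge0 (q 2); lra.
  have : 0 <= E / k by rewrite divr_ge0// ltW.
  rewrite /M; lra.
move=> r2; have sr : 0 < s r by apply: s0; lra.
have h : energy k s q r <= E := energy_nincr sys (ltr1n _ 2) r2.
have h1 := subr1_ln_ge0 sr; have h2 := subr1_ln_coercive sr.
have q2 := sqr_ge0 (q r).
have h3 : k * (s r / 2 - 1) <= k * (s r - 1 - ln (s r)) by rewrite ler_pM2l.
have h4 : 0 <= k * (s r - 1 - ln (s r)) by rewrite mulr_ge0// ltW.
split => //; last by move: h; rewrite /energy; lra.
have : s r / 2 - 1 <= E / k.
  by rewrite ler_pdivlMr// mulrC; move: h; rewrite /energy; lra.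
rewrite /M; lra.
Qed.

(** If q^2 + (s - 1)^2 were at least d everywhere, the corrected energy plus a
    positive multiple of ln r would be nonincreasing, although the corrected
    energy is bounded below. *)
Lemma damped_system_liminf (R : realType) (m b k : R) (s q : R -> R) (d : R) :
  damped_system m b k s q -> 0 < d ->
  exists2 r, 2 <= r & q r ^+ 2 + (s r - 1) ^+ 2 < d.
Proof.
move=> sys d0; have [[m0 b0 k0] s0 ds dq] := sys.
pose E := energy k s q; pose M := 2 * (E 2 / k + 1).
have [M2 sq_bound] := damped_system_bounded sys; rewrite -/E -/M in M2 sq_bound.
apply: contrapT => hn.
have big r : 2 <= r -> d <= q r ^+ 2 + (s r - 1) ^+ 2.
  by move=> r2; rewrite leNgt; apply/negP => h; apply: hn; exists r.
pose C := m + b * M.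
have D0 : 0 < M + C ^+ 2 / (2 * k).
  have : 0 <= C ^+ 2 / (2 * k)
    by apply: divr_ge0; [exact: sqr_ge0|rewrite mulr_ge0 ?(ltW k0)].
  lra.
(* The correction costs at most half of the dissipation m q^2. *)
pose e := m / 2 / (M + C ^+ 2 / (2 * k)).
have e0 : 0 < e by rewrite !divr_gt0.
have eE : e * (M + C ^+ 2 / (2 * k)) = m / 2 by rewrite divfK// gt_eqF.
pose c := Num.min (m / 2) (e * k / 2).
have c0 : 0 < c by rewrite lt_min !divr_gt0// mulr_gt0.
have cm : c <= m / 2 by rewrite ge_min lexx.
have ce : c <= e * k / 2 by rewrite ge_min lexx orbT.
pose f (r : R) := E r + e * (q r * (s r + (-1))) + c * d * ln r.
pose f' (r : R) := (- (m + b * s r) * q r ^+ 2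
    + e * (- (m + b * s r) * (q r * (s r - 1)) - k * (s r - 1) ^+ 2 + s r * q r ^+ 2)
    + c * d) / r.
have df (r : R) : 1 < r -> is_derive r 1 f (f' r).
  move=> r1; have r0 : 0 < r by lra.
  have h := is_derive1D (is_derive1D (is_derive_energy sys r1)
    (is_derive1Ml e (is_derive1M (dq r r1) (is_derive1Dr (-1) (ds r r1)))))
    (is_derive1Ml (c * d) (is_derive1_ln r0)).
  apply: (is_derive_eq h).
  by rewrite /f' /=; field; rewrite gt_eqF.
have f'0 r : 2 < r -> f' r <= 0.
  move=> r2; have r0 : 0 < r by lra.
  have [sr sM _] := sq_bound r (ltW r2).
  rewrite ler_pdivrMr// mul0r.
  have h := lyapunov_dissipation (q r) m0 b0 k0 sr sM (erefl C) (ltW e0) eE.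
  have h1 : c * d <= c * (q r ^+ 2 + (s r - 1) ^+ 2).
    by rewrite ler_pM2l// big// ltW.
  have h2 : c * q r ^+ 2 <= m / 2 * q r ^+ 2 by rewrite ler_wpM2r// sqr_ge0.
  have h3 : c * (s r - 1) ^+ 2 <= e * k / 2 * (s r - 1) ^+ 2.
    by rewrite ler_wpM2r// sqr_ge0.
  lra.
pose B := e * (2 * E 2 + M ^+ 2) / 2.
have lower r : 2 <= r -> - B <= E r + e * (q r * (s r + (-1))).
  move=> r2; have [sr sM qE] := sq_bound r r2.
  have E0 : 0 <= E r.
    by rewrite addr_ge0 ?divr_ge0 ?sqr_ge0// mulr_ge0 ?subr1_ln_ge0// ltW.
  have s2 : (s r - 1) ^+ 2 <= M ^+ 2.
    by rewrite -subr_ge0 subr_sqr mulr_ge0//; lra.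
  have h : - ((q r ^+ 2 + (s r - 1) ^+ 2) / 2) <= q r * (s r + -1).
    by have := sqr_ge0 (q r + (s r - 1)); rewrite sqrrD; lra.
  have : e * - ((2 * E 2 + M ^+ 2) / 2) <= e * (q r * (s r + -1)).
    by rewrite ler_pM2l//; lra.
  rewrite /B; lra.
pose V2 := E 2 + e * (q 2 * (s 2 + (-1))).
have B0 : 0 <= B + V2 by have := lower 2 (lexx _); rewrite -/V2; lra.
(* After the logarithmic time T, a decrease by at least c d per unit of log r
   takes the corrected energy from its value V2 at r = 2 to - B - 1 or less. *)
pose T := (B + V2 + 1) / (c * d).
have T0 : 0 <= T by rewrite divr_ge0 ?mulr_ge0 ?(ltW c0) ?(ltW d0)//; lra.
pose r := 2 * expR T.
have r2 : 2 <= r by rewrite ler_pMr//; have := expR_ge1Dx T; lra.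
have := is_derive_le0_nincr df (ltr1n _ 2) f'0 r2.
rewrite /f -/V2 /r lnM ?posrE ?expR_gt0// expRK -/r [c * d * (_ + T)]mulrDr.
have -> : c * d * T = B + V2 + 1.
  by rewrite mulrC divfK// gt_eqF// mulr_gt0.
have := lower r r2; lra.
Qed.

Lemma damped_system_cvg (R : realType) (m b k : R) (s q : R -> R) :
  damped_system m b k s q -> s r @[r --> +oo] --> (1 : R).
Proof.
move=> sys; have [[m0 b0 k0] s0 ds dq] := sys.
pose E := energy k s q; pose M := 2 * (E 2 / k + 1).
have [M2 sq_bound] := damped_system_bounded sys; rewrite -/E -/M in M2 sq_bound.
apply/cvgrPdist_lt => eta eta0.
have M1 : 0 < 2 * (M + 1) by lra.
have k1 : 0 < 1 + 2 * k by lra.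
(* Where q^2 + (s - 1)^2 < d1, the energy lies under the level
   k eta^2 / (2 (M + 1)) that forces |s - 1| < eta from there on; the bound
   2^-1 ^+ 2 keeps s in the range of subr1_ln_le_sqr. *)
pose d1 := k * eta ^+ 2 / (2 * (M + 1)) / (1 + 2 * k).
have d10 : 0 < d1 by rewrite !divr_gt0// mulr_gt0// exprn_gt0.
have [|r0 r02 hr0] := @damped_system_liminf R m b k s q (Num.min (2^-1 ^+ 2) d1) sys.
  by rewrite lt_min d10 exprn_gt0// invr_gt0.
move: hr0; rewrite lt_min => /andP[h1 h2].
have [sr0 _ _] := sq_bound r0 r02.
have s12 : 2^-1 <= s r0.
  rewrite leNgt; apply/negP => hs.
  have : 2^-1 ^+ 2 < (1 - s r0) ^+ 2 by rewrite ltr_sqr ?nnegrE; lra.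
  have -> : (1 - s r0) ^+ 2 = (s r0 - 1) ^+ 2 by ring.
  by have := sqr_ge0 (q r0); lra.
have Er0 : E r0 < k * eta ^+ 2 / (2 * (M + 1)).
  apply: (@le_lt_trans _ _ ((1 + 2 * k) * (q r0 ^+ 2 + (s r0 - 1) ^+ 2))).
    have h3 := subr1_ln_le_sqr s12.
    have h4 : k * (s r0 - 1 - ln (s r0)) <= k * (2 * (s r0 - 1) ^+ 2).
      by rewrite ler_pM2l.
    have := sqr_ge0 (q r0); have := sqr_ge0 (s r0 - 1).
    have : 0 <= k * q r0 ^+ 2 by rewrite mulr_ge0 ?sqr_ge0// ltW.
    rewrite /E /energy; lra.
  by rewrite mulrC -ltr_pdivlMr.
near=> r.
have rr0 : r0 <= r by near: r; apply: nbhs_pinfty_ge; exact: num_real.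
have [sr sM _] := sq_bound r (le_trans r02 rr0).
have Er : E r < k * eta ^+ 2 / (2 * (M + 1)).
  by apply: le_lt_trans Er0; apply: (energy_nincr sys) => //; lra.
rewrite distrC -(ger0_norm (ltW eta0)) -ltr_sqr ?nnegrE//.
rewrite !real_normK ?num_real//.
apply: le_lt_trans (subr1_ln_ge_sqr sr) _.
have h3 : 0 <= s r - 1 - ln (s r) by exact: subr1_ln_ge0.
have h4 : 2 * (s r + 1) * (s r - 1 - ln (s r))
       <= 2 * (M + 1) * (s r - 1 - ln (s r)).
  by apply: ler_wpM2r => //; lra.
apply: le_lt_trans h4 _.
rewrite mulrC -ltr_pdivlMr// -(ltr_pM2l k0) mulrA.
apply: le_lt_trans Er; rewrite /E /energy lerDr divr_ge0 ?sqr_ge0//.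
Unshelve. all: by end_near. Qed.

(** * Directional derivatives along lines *)

Lemma growth_line (R : realType) (n : nat) (f : 'rV[R]_n -> R) (x v : 'rV[R]_n)
    (t : R) :
  (fun h : R => h^-1 *: ((f \o shift (x + t *: v)) (h *: v) - f (x + t *: v)))
  = (fun h : R => h^-1 *: (((fun s => f (x + s *: v)) \o shift t) (h *: (1 : R))
                           - (fun s => f (x + s *: v)) t)).
Proof.
apply/funext => h /=; congr (_ *: (f _ - _)).
by rewrite [h *: 1]mulr1 scalerDl addrCA.
Qed.

(** No differentiability is assumed: both sides are limits of the same
    difference quotient. *)
Lemma derive_line (R : realType) (n : nat) (f : 'rV[R]_n -> R) (x v : 'rV[R]_n)
    (t : R) :
  'D_v f (x + t *: v) = derive1 (fun s : R => f (x + s *: v)) t.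
Proof. by rewrite derive1E /derive growth_line. Qed.

Lemma derivable_line (R : realType) (n : nat) (f : 'rV[R]_n -> R)
    (x v : 'rV[R]_n) (t : R) :
  derivable f (x + t *: v) v -> derivable (fun s : R => f (x + s *: v)) t 1.
Proof. by rewrite /derivable growth_line. Qed.

Lemma derive_ray (R : realType) (n : nat) (f : 'rV[R]_n -> R) (v : 'rV[R]_n)
    (t : R) :
  'D_v f (t *: v) = derive1 (fun s : R => f (s *: v)) t.
Proof.
rewrite -[t *: v]add0r derive_line; congr (_ t); congr derive1.
by apply/funext => s; rewrite add0r.
Qed.

Lemma derivable_ray (R : realType) (n : nat) (f : 'rV[R]_n -> R)
    (v : 'rV[R]_n) (t : R) :
  derivable f (t *: v) v -> derivable (fun s : R => f (s *: v)) t 1.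
Proof.
rewrite -[t *: v]add0r => /derivable_line.
by under [X in derivable X]eq_fun do rewrite add0r.
Qed.

(** * Reduction of the equation to the radial variable *)

Lemma enorm_basis_plane (R : realType) (n : nat) (i j : 'I_n) (r s : R) :
  i != j ->
  enorm (r *: basis_vec R i + s *: basis_vec R j) = Num.sqrt (r ^+ 2 + s ^+ 2).
Proof.
move=> ij; congr Num.sqrt; rewrite /dotp (bigD1 i)//= (bigD1 j) 1?eq_sym//=.
rewrite big1 => [|k /andP[ki kj]]; rewrite !mxE !eqxx.
  by rewrite (negbTE ij) eq_sym (negbTE ij) !mulr1 !mulr0 !addr0 add0r !expr2.
by rewrite (negbTE ki) (negbTE kj) !mulr0 addr0 mul0r.
Qed.

Lemma enorm_ray (R : realType) (n : nat) (i : 'I_n) (r : R) :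
  0 <= r -> enorm (r *: basis_vec R i) = r.
Proof.
move=> r0; rewrite /enorm /dotp (bigD1 i)//= big1 => [|k ki]; rewrite !mxE !eqxx.
  by rewrite mulr1 addr0 -expr2 sqrtr_sqr ger0_norm.
by rewrite (negbTE ki) mulr0 mul0r.
Qed.

Lemma setC_unit_ball (R : realType) (n : nat) (x : 'rV[R]_n) :
  (~` unit_ball R n) x <-> 1 <= enorm x.
Proof. by rewrite /unit_ball /setC /= leNgt; split => [/negP|/negP]. Qed.

Lemma near_gt_is_derive (R : realType) (a r d : R) (f g : R -> R) :
  a < r -> (forall s, a < s -> f s = g s) ->
  is_derive r 1 f d -> is_derive r 1 g d.
Proof.
move=> ar fg; apply: near_eq_is_derive.
by near=> s; apply: fg; near: s; exact: lt_nbhsr.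
Unshelve. all: by end_near. Qed.

Lemma is_derive1_val (R : realType) (f : R -> R) (x a : R) :
  is_derive x 1 f a -> derive1 f x = a.
Proof. by move=> [_ <-]; rewrite derive1E. Qed.

Lemma is_derive_hypot (R : realType) (r h : R) : 0 < r ->
  is_derive h 1 (fun s : R => Num.sqrt (r ^+ 2 + s ^+ 2))
    (h / Num.sqrt (r ^+ 2 + h ^+ 2)).
Proof.
move=> r0; have p0 : 0 < h ^+ 2 + r ^+ 2 by rewrite ltr_wpDl ?sqr_ge0// exprn_gt0.
have dh : is_derive h 1 (fun s : R => s * s + r ^+ 2) (h * 1 + h * 1).
  by apply: is_derive1Dr; apply: is_derive1M; exact: is_derive_id.
have -> : (fun s => Num.sqrt (r ^+ 2 + s ^+ 2)) =
  Num.sqrt \o (fun s : R => s * s + r ^+ 2).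
  by apply/funext => s /=; rewrite -expr2 addrC.
apply: is_derive_eq.
  by apply: is_derive1_comp; apply: is_derive1_sqrt; rewrite -expr2.
rewrite [in RHS]addrC -expr2; field.
by rewrite gt_eqF// sqrtr_gt0.
Qed.

(** The second derivative of a radial function L(|x|) in a direction orthogonal
    to x, at distance r = |x| from the origin, is L'(r) / r. *)
Lemma second_derive_hypot (R : realType) (L l : R -> R) (a r d : R) :
  0 <= a -> a < r -> (forall s, a < s -> is_derive s 1 L (l s)) ->
  is_derive r 1 l d ->
  derive1 (derive1 (fun s : R => L (Num.sqrt (r ^+ 2 + s ^+ 2)))) 0 = l r / r.
Proof.
move=> a0 ar dL dl; have r0 : 0 < r by lra.
pose rho (s : R) : R := Num.sqrt (r ^+ 2 + s ^+ 2).
have rho0 : rho 0 = r by rewrite /rho expr0n addr0 sqrtr_sqr gtr0_norm.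
have rho_ge s : r <= rho s.
  by rewrite -[leLHS]gtr0_norm// -sqrtr_sqr ler_wsqrtr// lerDl sqr_ge0.
have drho (h : R) : is_derive h 1 rho (h / rho h) by exact: is_derive_hypot.
(* The first derivative is h times a function differentiable at 0, so only
   the value of that function at 0 matters. *)
have -> : derive1 (fun s : R => L (Num.sqrt (r ^+ 2 + s ^+ 2))) =
    fun h => h * (l (rho h) * (rho h)^-1).
  apply/funext => h; apply: is_derive1_val.
  have dLr := dL (rho h) (lt_le_trans ar (rho_ge h)).
  apply: (is_derive_eq (is_derive1_comp dLr (drho h))).
  by rewrite mulrCA.
rewrite -rho0 in dl.
have rho_neq0 : rho 0 != 0 by rewrite rho0 gt_eqF.
have dV := is_deriveV rho_neq0 (drho 0).
have dg := is_derive1M (is_derive1_comp dl (drho 0)) dV.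
apply: is_derive1_val.
apply: (is_derive_eq (is_derive1M (is_derive_id (0 : R) 1) dg)).
by rewrite /= mul0r add0r mulr1 rho0.
Qed.

(** Here l is the logarithmic derivative of phi.  In dimension n + 1 there are n
    directions orthogonal to a ray. *)
Lemma radial_ode (R : realType) (n : nat) (alpha beta : R)
    (v : 'rV[R]_n.+1 -> R) (phi : R -> R) :
  radial_on (~` unit_ball R n.+1) v phi ->
  log_diffusion_solution alpha beta (~` unit_ball R n.+1) v ->
  exists l : R -> R, forall r : R, 1 < r ->
    [/\ 0 < phi r,
        is_derive r 1 phi (phi r * l r) &
        is_derive r 1 l
          (- (n%:R * l r / r + alpha * phi r + beta * r * (phi r * l r)))].
Proof.
move=> hrad [v0 [U [w [_ AU C2w wv pde]]]].
pose e : 'rV[R]_n.+1 := basis_vec R ord0.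
(* The profile read off on the ray through e; it agrees with phi on r >= 1,
   where the extension w agrees with v. *)
pose P (r : R) := w (r *: e).
have Ae (r : R) : 1 <= r -> (~` unit_ball R n.+1) (r *: e).
  by move=> r1; apply/setC_unit_ball; rewrite enorm_ray//; lra.
have Pphi (r : R) : 1 <= r -> P r = phi r.
  move=> r1; rewrite /P wv ?hrad ?enorm_ray//; try exact: Ae.
  lra.
have wP x : 1 <= enorm x -> w x = P (enorm x).
  by move=> x1; rewrite Pphi// -hrad ?wv//; exact/setC_unit_ball.
have P0 (r : R) : 1 <= r -> 0 < P r.
  by move=> r1; rewrite /P wv; [apply: v0|]; exact: Ae.
have P'E : derive1 P = fun r : R => partial ord0 w (r *: e).
  by apply/funext => r; rewrite /partial derive_ray.
have derP (r : R) : 1 <= r -> derivable P r 1.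
  move=> r1; apply: derivable_ray.
  by have [_ /(_ ord0)[]] := C2w _ (AU _ (Ae r r1)).
have derP' (r : R) : 1 <= r -> derivable (derive1 P) r 1.
  move=> r1; rewrite P'E; apply: derivable_ray.
  by have [_ _ /(_ ord0 ord0)[]] := C2w _ (AU _ (Ae r r1)).
pose l (r : R) := derive1 P r * (P r)^-1.
have dP (r : R) : 1 <= r -> is_derive r 1 P (P r * l r).
  move=> r1; apply: DeriveDef; first exact: derP.
  by rewrite -derive1E /l mulrCA divff ?mulr1// gt_eqF// P0.
have dlnP (r : R) : 1 <= r -> is_derive r 1 (fun s => ln (P s)) (l r).
  move=> r1; apply: is_derive_eq.
    by apply: is_derive1_lnf; [exact: P0|exact: dP].
  by rewrite mulrC mulKf// gt_eqF// P0.
have dl (r : R) : 1 <= r -> is_derive r 1 l (derive1 l r).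
  move=> r1; apply: DeriveDef; last by rewrite derive1E.
  apply: derivableM; first exact: derP'.
  by apply: derivableV; [rewrite gt_eqF// P0|exact: derP].
exists l => r r1; have r1' := ltW r1.
have radial_part : partial ord0 (partial ord0 (fun y => ln (w y))) (r *: e)
    = derive1 l r.
  rewrite /partial derive_ray; apply: is_derive1_val.
  apply: (near_gt_is_derive r1 _ (dl r r1')) => s s1.
  by rewrite derive_ray; apply/esym/is_derive1_val/dlnP/ltW.
have angular_part (j : 'I_n) :
    partial (lift ord0 j) (partial (lift ord0 j) (fun y => ln (w y))) (r *: e)
    = l r / r.
  set i := lift ord0 j.
  (* The point r e is moved along r e + s e_i, on which v is P (sqrt (r^2 + s^2))
     for every s because these points all have norm at least r > 1. *)
  rewrite /partial -[r *: e]addr0 -(scale0r (basis_vec R i)) derive_line.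
  under [X in derive1 X]eq_fun do rewrite derive_line.
  have -> : (fun s => ln (w (r *: e + s *: basis_vec R i))) =
      (fun s => ln (P (Num.sqrt (r ^+ 2 + s ^+ 2)))).
    apply/funext => s; rewrite wP enorm_basis_plane//.
    rewrite -[leLHS]gtr0_norm// -sqrtr_sqr ler_wsqrtr//.
    by rewrite expr1n ler_wpDr ?sqr_ge0// expr_ge1//; lra.
  apply: (@second_derive_hypot R (fun s => ln (P s)) l 1 r _
            ler01 r1 _ (dl r r1')) => s s1.
  exact/dlnP/ltW.
have grad : dotp (r *: e) (gradient w (r *: e)) = r * (P r * l r).
  rewrite /dotp big_ord_recl big1 => [|j _]; rewrite !mxE !eqxx/=.
    rewrite mulr1 addr0 /partial derive_ray; congr (_ * _).
    by apply/is_derive1_val/dP.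
  by rewrite mulr0 mul0r.
have := pde _ (Ae r r1').
rewrite grad /laplacian big_ord_recl radial_part.
under eq_bigr do rewrite angular_part.
rewrite sumr_const card_ord -/(P r) -mulr_natl => ode.
split; first by rewrite -Pphi// P0.
  rewrite -Pphi//; apply: (near_gt_is_derive r1 _ (dP r r1')) => s s1.
  exact/Pphi/ltW.
rewrite -Pphi//; apply: (is_derive_eq (dl r r1')).
lra.
Qed.

Theorem theorem1p4 (R : realType) (n : nat) (rho1 alpha beta : R)
    (v : 'rV[R]_n -> R) (phi : R -> R)
    (hn : (3 <= n)%N) (hrho1 : 0 < rho1) (hbeta : 0 < beta)
    (halpha : alpha = 2 * beta + rho1)
    (hrad : radial_on (~` unit_ball R n) v phi)
    (hsol : log_diffusion_solution alpha beta (~` unit_ball R n) v) :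
  r ^+ 2 * phi r @[r --> +oo] --> 2 * (n%:R - 2) / (alpha - 2 * beta).
Proof.
case: n v hn hrad hsol => // n v hn hrad hsol.
have [l ode] := radial_ode hrad hsol.
pose m : R := n.+1%:R - 2.
have m0 : 0 < m by rewrite subr_gt0 ltr_nat.
have nE : n%:R = m + 1 :> R by rewrite /m -natr1; lra.
pose s (r : R) := rho1 / (2 * m) * (r * r * phi r).
pose q (r : R) := r * l r + 2.
have sys : damped_system m (beta * (2 * m) / rho1) (2 * m) s q.
  split.
  - by rewrite m0 !divr_ge0 ?mulr_gt0// ?mulr_ge0 ?ltW.
  - move=> r r1; have [phi0 _ _] := ode r r1.
    by rewrite !mulr_gt0 ?invr_gt0 ?mulr_gt0//; lra.
  - move=> r r1; have [phi0 dphi _] := ode r r1.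
    have dr := is_derive_id r (1 : R).
    apply: (is_derive_eq (is_derive1Ml _ (is_derive1M (is_derive1M dr dr) dphi))).
    by rewrite /= /s /q; field; rewrite !gt_eqF//; lra.
  - move=> r r1; have [phi0 _ dl] := ode r r1.
    apply: (is_derive_eq (is_derive1Dr _ (is_derive1M (is_derive_id r (1 : R)) dl))).
    by rewrite /= /s /q nE halpha; field; rewrite !gt_eqF//; lra.
have -> : alpha - 2 * beta = rho1 by rewrite halpha; lra.
rewrite -/m -[X in _ --> X]mulr1.
have -> : (fun r => r ^+ 2 * phi r) = fun r => 2 * m / rho1 * s r.
  by apply/funext => r; rewrite /s; field; rewrite !gt_eqF.
by apply: cvgMr; exact: damped_system_cvg sys.
Qed.
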